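(* Let $L_+,L_-,L_0,L_\infty$ be four link diagrams in the plane that are identical outside a small disk, where inside the disk $L_+$ has a single crossing, $L_-$ has the crossing obtained from that of $L_+$ by a crossing change, $L_0$ is obtained from $L_+$ by replacing this crossing by its $A$-splicing (equivalently, from $L_-$ by the $B$-splicing), and $L_\infty$ is obtained from $L_+$ by replacing this crossing by its $B$-splicing (equivalently, from $L_-$ by the $A$-splicing). Then $$\chi(G(L_+))+\chi(G(L_-))=\chi(G(L_0))+\chi(G(L_\infty))-2,$$ where $\chi(G(D))$ is the Euler characteristic of the Turaev surface of the link diagram $D$.
   Context: Splicings: at a crossing of a link diagram in the plane, the $A$-splicing replaces the crossing by two disjoint arcs so as to merge the two (opposite) corners swept out when the over-strand is rotated counterclockwise until it reaches the under-strand; the $B$-splicing merges the other two corners. Turaev surface of a non-split diagram: a link diagram $D$ is split if there is a circle in the plane disjoint from $D$ with part of $D$ inside and part of $D$ outside the circle; otherwise it is non-split. Let $D$ be non-split and let $\Gamma\subset\mathbb{R}^2\subset\mathbb{R}^3$ be the 4-valent plane graph obtained by changing each crossing of $D$ into a vertex. Outside neighborhoods of the vertices, replace each arc of $\Gamma$ by a band perpendicular to the plane. In a neighborhood of each vertex place a saddle, so that the resulting surface has boundary a collection of disjoint circles, where the circles obtained from $D$ by choosing the $A$-splicing at every crossing lie above the plane and the circles obtained by choosing the $B$-splicing at every crossing lie below the plane. Capping each boundary circle with a disk gives a closed oriented surface $G(D)$, the Turaev surface. (For a crossingless diagram of one circle this is an annulus capped by two disks, i.e. a sphere.) Turaev surface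 of a split diagram: if $D=D_1\coprod\dots\coprod D_n$ is a disjoint union of non-split diagrams (its split components), then $G(D)$ is the disjoint union $G(D_1)\coprod\dots\coprod G(D_n)$, so that $\chi(G(D))=\sum_i\chi(G(D_i))$. *)

(* Defs.v *)
From mathcomp Require Import all_boot all_order all_algebra.

Set Implicit Arguments.
Unset Strict Implicit.
Unset Printing Implicit Defensive.

Import GRing.Theory.
Local Open Scope ring_scope.

(* Link diagrams in the plane, considered up to planar isotopy, are presented *)
(* as Lomonaco-Kauffman mosaics: an m x n array of unit squares, each         *)
(* containing one of eleven local pictures, whose strands meet the boundary   *)
(* of the square at midpoints of its sides.                                   *)

(* The sides of a square in counterclockwise order: 0 = East, 1 = North,      *)
(* 2 = West, 3 = South.  Corner s of the square is the one between the sides  *)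
(* s and s + 1.                                                               *)
Definition side := 'Z_4.

(* An arc cutting off corner s, and a straight segment (East-West for false,  *)
(* North-South for true).                                                     *)
Definition corner_arc (s : side) : {set side} := [set s; s + 1].
Definition straight (b : bool) : {set side} := [set b%:R; b%:R + 2%:R].

Inductive tile : Type :=
| Blank
| Straight (b : bool)
| Corner (s : side)
| Corners (b : bool)    (* arcs cutting off the opposite corners b and b + 2 *)
| Crossing (b : bool).  (* the over-strand is straight b                     *)

(* The connected components of the picture (of the projection to the plane,   *)
(* for a crossing), each identified with the set of sides that it meets.      *)
Definition pieces (t : tile) : {set {set side}} :=
  match t with
  | Blank => set0
  | Straight b => [set straight b]
  | Corner s => [set corner_arc s]
  | Corners b => [set corner_arc b%:R; corner_arc (b%:R + 2%:R)]
  | Crossing _ => [set [set: side]]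
  end.

Definition ends (t : tile) : {set side} := cover (pieces t).

(* Rotating the over-strand of Crossing b counterclockwise until it reaches   *)
(* the under-strand sweeps out the corners b and b + 2.  The A-splicing       *)
(* merges these two corners, so its arcs cut off the two other ones.          *)
Definition spliceA (t : tile) : tile :=
  if t is Crossing b then Corners (~~ b) else t.

Definition spliceB (t : tile) : tile :=
  if t is Crossing b then Corners b else t.

Definition crossing_change (t : tile) : tile :=
  if t is Crossing b then Crossing (~~ b) else t.

(* Erases the pieces of the picture that are not contained in T.              *)
Definition keep (T : {set side}) (t : tile) : tile :=
  match t with
  | Blank => Blank
  | Straight b => if straight b \subset T then Straight b else Blank
  | Corner s => if corner_arc s \subset T then Corner s else Blank
  | Corners b =>
      let s : side := b%:R in
      match corner_arc s \subset T, corner_arc (s + 2%:R) \subset T with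
      | true, true => Corners b
      | true, false => Corner s
      | false, true => Corner (s + 2%:R)
      | false, false => Blank
      end
  | Crossing b => if [set: side] \subset T then Crossing b else Blank
  end.

Definition square (m n : nat) : finType := ('I_m * 'I_n)%type.

(* Midpoints of the sides of the squares, in half-unit coordinates: the       *)
(* square (i, j) has centre (2i + 1, 2j + 1).                                 *)
Definition point (m n : nat) : finType := ('I_(m.*2.+1) * 'I_(n.*2.+1))%type.

Definition midpoint (m n : nat) (x : square m n) (s : side) : point m n :=
  let: (i, j) := x in
  match val s with
  | 0%N => (inord i.*2.+2, inord j.*2.+1)
  | 1%N => (inord i.*2.+1, inord j.*2.+2)
  | 2%N => (inord i.*2, inord j.*2.+1)
  | _ => (inord i.*2.+1, inord j.*2)
  end.

Definition mosaic (m n : nat) : Type := square m n -> tile.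
Identity Coercion tile_at : mosaic >-> Funclass.

(* A mosaic is a link diagram when no strand stops at a side of a square.     *)
Record diagram (m n : nat) : Type := Diagram {
  mosaic_of :> mosaic m n;
  diagram_closed : forall (x : square m n) (s : side),
    s \in ends (mosaic_of x) ->
    exists (y : square m n) (t : side),
      [/\ (y, t) <> (x, s), midpoint y t = midpoint x s
        & t \in ends (mosaic_of y)]
}.

(* A piece of the picture in a given square.                                  *)
Definition local_piece (m n : nat) : finType :=
  (square m n * {set side})%type.

Section Mosaic.

Variables m n : nat.
Implicit Type D : mosaic m n.

Definition piece_set D : {set local_piece m n} :=
  [set u : local_piece m n | u.2 \in pieces (D u.1)].

Definition piece_ends (u : local_piece m n) : {set point m n} :=
  midpoint u.1 @: u.2.

Definition support D : {set point m n} :=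
  \bigcup_(u in piece_set D) piece_ends u.

Definition linked D : rel (point m n) := fun p q =>
  [exists u in piece_set D, (p \in piece_ends u) && (q \in piece_ends u)].

(* The connected components of the projection of D to the plane, each given   *)
(* by the midpoints it contains.  A circle disjoint from D separates parts of *)
(* D if and only if there is more than one component, so these are the split  *)
(* components of D.  If D has no crossing, they are the circles of D.         *)
Definition components D : {set {set point m n}} :=
  equivalence_partition (connect (linked D)) (support D).

Definition subdiagram D (S : {set point m n}) : mosaic m n :=
  fun x => keep [set s | midpoint x s \in S] (D x).

Definition stateA D : mosaic m n := fun x => spliceA (D x).
Definition stateB D : mosaic m n := fun x => spliceB (D x).

End Mosaic.

(* Finite two-dimensional cell complexes given by the incidence of their      *)
(* cells.  The complexes below are regular: every edge has two distinct ends  *)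
(* and every face is a disk attached along an embedded circle of edges, so    *)
(* that incidence determines the space.                                       *)
Record complex : Type := Complex {
  vertex : finType;
  edge : finType;
  face : finType;
  edge_boundary : edge -> {set vertex};
  face_boundary : face -> {set edge}
}.

Definition euler (K : complex) : int :=
  #|vertex K|%:Z - #|edge K|%:Z + #|face K|%:Z.

Definition disjoint_union (I : finType) (K : I -> complex) : complex :=
  {| vertex := {i : I & vertex (K i)};
     edge := {i : I & edge (K i)};
     face := {i : I & face (K i)};
     edge_boundary := fun e =>
       Tagged (fun i => vertex (K i)) @: edge_boundary (tagged e);
     face_boundary := fun f =>
       Tagged (fun i => edge (K i)) @: face_boundary (tagged f) |}.

Section Turaev.

Variables m n : nat.
Implicit Type D : mosaic m n.

(* Each midpoint p of D carries the vertical segment p x [-1, 1], with upper  *)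
(* vertex (p, true) and lower vertex (p, false).                              *)
Definition turaev_vertex D : finType :=
  ({p : point m n | p \in support D} * bool)%type.

(* Vertical segments; arcs of the all-A state, above the plane; arcs of the   *)
(* all-B state, below the plane.                                              *)
Definition turaev_edge D : finType :=
  ({p : point m n | p \in support D}
   + {u : local_piece m n | u \in piece_set (stateA D)}
   + {u : local_piece m n | u \in piece_set (stateB D)})%type.

(* Sheets: the bands perpendicular to the plane over the arcs in the squares, *)
(* and the saddles at the crossings.  Then the disks capping the boundary     *)
(* circles above and below the plane.                                         *)
Definition turaev_face D : finType :=
  ({u : local_piece m n | u \in piece_set D}
   + {C : {set point m n} | C \in components (stateA D)}
   + {C : {set point m n} | C \in components (stateB D)})%type.

Definition turaev_edge_boundary D (e : turaev_edge D) :
    {set turaev_vertex D} :=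
  match e with
  | inl (inl p) => [set v | v.1 == p]
  | inl (inr u) => [set v | (val v.1 \in piece_ends (val u)) && v.2]
  | inr u => [set v | (val v.1 \in piece_ends (val u)) && ~~ v.2]
  end.

(* A sheet is bounded by the vertical segments at its ends, by the arcs of    *)
(* the A-splicing above it and by the arcs of the B-splicing below it.        *)
Definition turaev_face_boundary D (f : turaev_face D) :
    {set turaev_edge D} :=
  match f with
  | inl (inl u) =>
      let over_u (w : local_piece m n) :=
        (w.1 == (val u).1) && (w.2 \subset (val u).2) in
      [set e : turaev_edge D |
        match e with
        | inl (inl p) => val p \in piece_ends (val u)
        | inl (inr w) => over_u (val w)
        | inr w => over_u (val w)
        end]
  | inl (inr C) =>
      [set e : turaev_edge D |
        if e is inl (inr w) then piece_ends (val w) \subset val C else false]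
  | inr C =>
      [set e : turaev_edge D |
        if e is inr w then piece_ends (val w) \subset val C else false]
  end.

Definition turaev_nonsplit D : complex :=
  {| vertex := turaev_vertex D;
     edge := turaev_edge D;
     face := turaev_face D;
     edge_boundary := @turaev_edge_boundary D;
     face_boundary := @turaev_face_boundary D |}.

Definition turaev D : complex :=
  disjoint_union
    (fun S : {S : {set point m n} | S \in components D} =>
       turaev_nonsplit (subdiagram D (val S))).

End Turaev.

(* Main.v *)
Require Import Defs.
From mathcomp Require Import all_boot all_order all_algebra.
From mathcomp Require Import zify.

Set Implicit Arguments.
Unset Strict Implicit.
Unset Printing Implicit Defensive.

Import GRing.Theory.

(** The Turaev surface of a diagram D has one vertical segment, with two ends,
over each point where D meets a side of a square; one arc above (below) the
plane for each piece of the all-A (all-B) state; one sheet for each piece of D;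
and one capping disk for each circle of the two states.  Hence

  chi = #pieces(D) + #points(D) + caps_minus_arcs(A-state)
                                + caps_minus_arcs(B-state),

where [caps_minus_arcs] is the number of circles of a state minus its number of
arcs ([euler_turaev_nonsplit]).  This is clear when the cells are counted over
the whole of D, whereas the surface is defined as the disjoint union of those of
the split components.  The two counts agree ([euler_turaev]) because each cell
lies over exactly one split component: splicing only cuts pieces into smaller
ones, so circles of states never leave a split component.

Suppose that M arises from D by an a-splicing of one crossing, where a is A or
B.  Then D and M have the same a-state, hence also the same points, as splicing
preserves the ends of a tile ([state_spliced], [support_spliced]); and M has one
piece more than D, since a crossing is one piece and its splicing two
([card_piece_set_spliced]).  Now L_0 is the A-splicing of L_+ and the B-splicing
of L_-, while L_oo is the B-splicing of L_+ and the A-splicing of L_-.  So the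
four state terms on the left match the four on the right, the points match, and
the pieces on the right outnumber those on the left by two. *)

(** * Counting over the blocks of a partition *)

(** A nonempty set lies in at most one block of P, so each F j lies in exactly
one block, and exchanging the sums gives the result. *)
Lemma sum_card_inside (T J : finType) (P : {set {set T}}) (X : {set J})
    (F : J -> {set T}) :
  trivIset P -> {in X, forall j, F j != set0} ->
  {in X, forall j, exists2 S, S \in P & F j \subset S} ->
  \sum_(S in P) #|[set j in X | F j \subset S]| = #|X|.
Proof.
move=> tiP F_n0 F_in.
under eq_bigr => S _ do rewrite -sum1dep_card.
rewrite (exchange_big_dep (mem X)) /=; last by move=> S j _ /andP[].
rewrite -sum1_card; apply: eq_bigr => j jX.
have [S SP sFS] := F_in j jX; have /set0Pn[p pF] := F_n0 j jX.
rewrite (big_pred1 S) // => S'; rewrite jX /=.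
apply/andP/eqP => [[S'P sFS']|-> //].
by rewrite -(def_pblock tiP S'P (subsetP sFS' p pF))
           (def_pblock tiP SP (subsetP sFS p pF)).
Qed.

(** * Components of hypergraphs *)

(** A diagram and its states are seen here as hypergraphs: the vertices are the
midpoints, and a piece u is a hyperedge joining the vertices in [e u]. *)
Section Hypergraph.

Variables (T I : finType) (e : I -> {set T}).
Implicit Types (A B : {set I}) (S C : {set T}).

Definition link A : rel T :=
  fun p q => [exists u in A, (p \in e u) && (q \in e u)].

Definition hull A : {set T} := \bigcup_(u in A) e u.

Definition comps A : {set {set T}} :=
  equivalence_partition (connect (link A)) (hull A).

Definition within A S : {set I} := [set u in A | e u \subset S].

Lemma linkP A p q :
  reflect (exists2 u, u \in A & p \in e u /\ q \in e u) (link A p q).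
Proof.
apply: (iffP exists_inP) => [[u uA /andP[pu qu]]|[u uA [pu qu]]].
  by exists u.
by exists u; rewrite ?pu.
Qed.

Lemma hullP A p : reflect (exists2 u, u \in A & p \in e u) (p \in hull A).
Proof. exact: bigcupP. Qed.

Lemma connect_link_sym A : connect_sym (link A).
Proof.
apply: sym_connect_sym => p q.
by apply/linkP/linkP => -[u uA [pu qu]]; exists u.
Qed.

Lemma comps_partition A : partition (comps A) (hull A).
Proof.
apply: equivalence_partitionP => p q r _ _ _; split; first exact: connect0.
by move=> pq; apply: (same_connect (@connect_link_sym A) pq).
Qed.

Lemma compsP A C :
  reflect (exists2 p, p \in hull A
             & C = [set q in hull A | connect (link A) p q])
          (C \in comps A).
Proof. exact: imsetP. Qed.

Lemma comps_sub A C : C \in comps A -> C \subset hull A.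
Proof. by case/compsP => p _ ->; apply/subsetP => q; rewrite inE => /andP[]. Qed.

Lemma comps_link A C p q : C \in comps A -> link A p q -> p \in C -> q \in C.
Proof.
move=> /compsP[r _ ->] pq; rewrite !inE => /andP[_ rp].
rewrite (connect_trans rp (connect1 pq)) andbT.
by have /linkP[u uA [_ qu]] := pq; apply/hullP; exists u.
Qed.

Lemma comps_saturated A C u p :
  C \in comps A -> u \in A -> p \in e u -> p \in C -> e u \subset C.
Proof.
move=> CA uA pu pC; apply/subsetP => q qu.
by apply: comps_link CA _ pC; apply/linkP; exists u.
Qed.

Lemma hull_comps A p : p \in hull A -> exists2 C, C \in comps A & p \in C.
Proof.
move=> pA; exists (pblock (comps A) p).
  by rewrite pblock_mem // (cover_partition (comps_partition A)).
by rewrite mem_pblock (cover_partition (comps_partition A)).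
Qed.

(** B refines A when its hyperedges are parts of those of A and cover the same
vertices.  A state of a diagram refines the diagram in this sense, and the
components of B then lie in those of A.  Taking B = A is allowed. *)
Section Refinement.

Variables A B : {set I}.
Hypothesis e_n0 : {in B, forall u, e u != set0}.
Hypothesis refine : {in B, forall u, exists2 v, v \in A & e u \subset e v}.
Hypothesis hull_eq : hull B = hull A.

Lemma refine_link p q : link B p q -> link A p q.
Proof.
case/linkP => u uB [pu qu]; have [v vA /subsetP suv] := refine uB.
by apply/linkP; exists v => //; split; apply: suv.
Qed.

Lemma refine_saturated S u p :
  S \in comps A -> u \in B -> p \in e u -> p \in S -> e u \subset S.
Proof.
move=> SA uB pu pS; apply/subsetP => q qu.
by apply: comps_link SA _ pS; apply: refine_link; apply/linkP; exists u.
Qed.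

Lemma hull_within S : S \in comps A -> hull (within B S) = S.
Proof.
move=> SA; apply/setP => p; apply/hullP/idP => [[u]|pS].
  by rewrite inE => /andP[_ /subsetP uS] /uS.
have /hullP[u uB pu] : p \in hull B by rewrite hull_eq (subsetP (comps_sub SA)).
by exists u => //; rewrite inE uB (refine_saturated SA uB pu).
Qed.

Lemma connect_within S p q : S \in comps A -> p \in S ->
  connect (link (within B S)) p q = connect (link B) p q.
Proof.
move=> SA pS; apply/idP/idP.
  apply: connect_sub => r s /linkP[u]; rewrite inE => /andP[uB _] rs.
  by apply: connect1; apply/linkP; exists u.
case/connectP => w; elim: w p pS => [|r w IHw] p pS /= => [_ -> //|].
case/andP => pr rw qw; have rS := comps_link SA (refine_link pr) pS.
apply: connect_trans (connect1 _) (IHw r rS rw qw).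
have /linkP[u uB pru] := pr; apply/linkP; exists u => //.
by rewrite inE uB (refine_saturated SA uB pru.1).
Qed.

Lemma connect_refine S p q :
  S \in comps A -> p \in S -> connect (link B) p q -> q \in S.
Proof.
move=> SA pS /connectP[w]; elim: w p pS => [|r w IHw] p pS /= => [_ -> //|].
case/andP => pr; apply: IHw; exact: comps_link SA (refine_link pr) pS.
Qed.

(** A path of B starting in S stays in S, and uses only hyperedges inside S, so
restricting to S does not break the components that S contains. *)
Lemma comps_within S : S \in comps A ->
  comps (within B S) = [set C in comps B | C \subset S].
Proof.
move=> SA; have sSB : S \subset hull B by rewrite hull_eq comps_sub.
have block p : p \in S ->
    [set q in S | connect (link (within B S)) p q]
    = [set q in hull B | connect (link B) p q].
  move=> pS; apply/setP => q; rewrite !inE connect_within //.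
  apply: andb_id2r => pq; have qS := connect_refine SA pS pq.
  by rewrite qS (subsetP sSB).
apply/setP => C; rewrite inE.
apply/compsP/andP => [[p]|[/compsP[p pB ->] /subsetP CS]].
  rewrite hull_within // => pS ->; rewrite block //; split.
    by apply/compsP; exists p => //; rewrite (subsetP sSB).
  by apply/subsetP => q; rewrite inE => /andP[_]; apply: connect_refine.
have pS : p \in S by apply: CS; rewrite inE pB connect0.
by exists p; rewrite ?hull_within ?block.
Qed.

Lemma sum_card_within : \sum_(S in comps A) #|within B S| = #|B|.
Proof.
have [_ tiA _] := and3P (comps_partition A).
apply: sum_card_inside => // u uB; have /set0Pn[p pu] := e_n0 uB.
have [|S SA pS] := @hull_comps A p.
  by rewrite -hull_eq; apply/hullP; exists u.
by exists S => //; apply: refine_saturated pS.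
Qed.

Lemma sum_card_hull_within :
  \sum_(S in comps A) #|hull (within B S)| = #|hull B|.
Proof.
rewrite hull_eq (card_partition (comps_partition A)).
by apply: eq_bigr => S /hull_within->.
Qed.

Lemma sum_card_comps_within :
  \sum_(S in comps A) #|comps (within B S)| = #|comps B|.
Proof.
have [_ tiA _] := and3P (comps_partition A).
under eq_bigr => S SA do rewrite comps_within //.
apply: (sum_card_inside (F := id)) => // C /compsP[p pB ->].
  by apply/set0Pn; exists p; rewrite inE pB connect0.
have [|S SA pS] := @hull_comps A p; first by rewrite -hull_eq.
by exists S => //; apply/subsetP => q; rewrite inE => /andP[_]; apply: connect_refine.
Qed.

End Refinement.

End Hypergraph.

(** * Splicing and erasing in a square *)

Local Open Scope ring_scope.

(** Both splicings as one family: [splice true] is convertible to [spliceA] and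
[splice false] to [spliceB]. *)
Definition splice (a : bool) (t : tile) : tile :=
  if t is Crossing b then Corners (a (+) b) else t.

Lemma pieces_n0 t P : P \in pieces t -> P != set0.
Proof.
have arc_n0 s : corner_arc s != set0 by apply/set0Pn; exists s; rewrite !inE eqxx.
case: t => [|b|s|b|b] /=; rewrite !inE //.
- by move/eqP->; apply/set0Pn; exists b%:R; rewrite !inE eqxx.
- by move=> /eqP->; exact: arc_n0.
- by case/orP => /eqP->; exact: arc_n0.
- by move/eqP->; apply/set0Pn; exists 0; rewrite inE.
Qed.

Lemma ends_splice a t : ends (splice a t) = ends t.
Proof.
case: t => //= b; rewrite /ends /cover /= big_set1.
apply/setP => s; rewrite inE; apply/bigcupP.
have [s0|s2] := boolP (s \in corner_arc (a (+) b)%:R).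
  by exists (corner_arc (a (+) b)%:R) => //; rewrite !inE eqxx.
exists (corner_arc ((a (+) b)%:R + 2%:R)); first by rewrite !inE eqxx orbT.
by move: s2; case: (a (+) b); rewrite !inE; case: s => [[|[|[|[|]]]] ?].
Qed.

Lemma splice_refine a t P : P \in pieces (splice a t) ->
  exists2 Q, Q \in pieces t & P \subset Q.
Proof.
case: t => [|b|s|b|b] Pt; try by exists P.
by exists [set: side]; rewrite ?inE ?subsetT.
Qed.

Lemma pieces_keep T t : pieces (keep T t) = [set P in pieces t | P \subset T].
Proof.
have inif (Q P : {set side}) : (P == Q) && (P \subset T) =
    (P \in if Q \subset T then [set Q] else set0).
  by case: eqVneq => [->|/negbTE PQ]; case: ifP; rewrite !inE ?eqxx ?PQ.
have one (Q : {set side}) : [set P in [set Q] | P \subset T] =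
    if Q \subset T then [set Q] else set0.
  by apply/setP => P; rewrite -inif !inE.
have pair (Q R : {set side}) : [set P in [set Q; R] | P \subset T] =
    (if Q \subset T then [set Q] else set0)
      :|: (if R \subset T then [set R] else set0).
  by apply/setP => P; rewrite in_setU -!inif !inE andb_orl.
case: t => [|b|s|b|b] /=; first by apply/setP => P; rewrite !inE.
- by rewrite one; case: ifP.
- by rewrite one; case: ifP.
- by rewrite pair; case: ifP; case: ifP => _ _ /=; rewrite ?setU0 ?set0U.
- by rewrite one; case: ifP.
Qed.

(** Erasing and splicing do not commute in general: an arc of the splicing may
lie in T while the crossing does not.  They do when T contains or avoids each
piece, as a split component does. *)
Lemma splice_keep a (T : {set side}) t :
  {in pieces t, forall P : {set side}, P :&: T != set0 -> P \subset T} ->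
  splice a (keep T t) = keep T (splice a t).
Proof.
case: t => [|b|s|b|b] sat //=; try by repeat case: ifP.
(* The crossing is its own only piece, so T is empty or full. *)
have [->|T_n0] := eqVneq T set0.
  have nsub u P : P \in pieces u -> (P \subset set0) = false.
    by move/pieces_n0/negbTE; rewrite subset0.
  rewrite (nsub (Crossing b)) ?inE // !(nsub (Corners (a (+) b))) //.
    by rewrite !inE eqxx orbT.
  by rewrite !inE eqxx.
have -> : T = setT.
  apply/setP => s; rewrite inE.
  by rewrite (subsetP (sat [set: side] _ _)) ?inE ?setTI.
by rewrite !subsetT.
Qed.

Lemma card_pieces_splice a b : #|pieces (splice a (Crossing b))| = 2%N.
Proof.
rewrite /= cards2; case: eqP => // /setP/(_ (a (+) b)%:R).
by rewrite !inE; case: (a (+) b).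
Qed.

(** * Cells of the Turaev surface *)

Local Notation support := Defs.support.

Section Mosaic.

Variables m n : nat.
Implicit Types (D M : mosaic m n) (S : {set point m n}).

Definition state (a : bool) D : mosaic m n := fun x => splice a (D x).

Lemma eq_piece_set D M : D =1 M -> piece_set D = piece_set M.
Proof. by move=> DM; apply/setP => u; rewrite !inE DM. Qed.

Lemma components_piece_set D :
  components D = comps (@piece_ends m n) (piece_set D).
Proof. by []. Qed.

Lemma support_piece_set D : support D = hull (@piece_ends m n) (piece_set D).
Proof. by []. Qed.

Lemma supportP D p :
  reflect (exists x s, s \in ends (D x) /\ p = midpoint x s) (p \in support D).
Proof.
rewrite support_piece_set.
apply: (iffP (hullP _ _ _)) => [[[x P]]|[x [s [/bigcupP[P PD sP] ->]]]].
  rewrite inE /= => PD /imsetP[s sP ->]; exists x, s; split=> //.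
  by apply/bigcupP; exists P.
by exists (x, P); rewrite ?inE //; apply: imset_f.
Qed.

(** The support depends only on the ends of the tiles, which splicing keeps. *)
Lemma support_state a D : support (state a D) = support D.
Proof.
apply/setP => p; apply/supportP/supportP => -[x [s sx]];
  by exists x, s; move: sx; rewrite ends_splice.
Qed.

Lemma piece_ends_n0 D u : u \in piece_set D -> piece_ends u != set0.
Proof.
by rewrite inE => /pieces_n0; apply: contraNneq => /eqP; rewrite imset_eq0.
Qed.

Lemma state_refine a D : {in piece_set (state a D), forall u,
  exists2 v, v \in piece_set D & piece_ends u \subset piece_ends v}.
Proof.
move=> [x P]; rewrite inE => /splice_refine[Q QD sPQ].
by exists (x, Q); rewrite ?inE //; apply: imsetS.
Qed.

Lemma piece_set_subdiagram D S :
  piece_set (subdiagram D S) = within (@piece_ends m n) (piece_set D) S.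
Proof.
apply/setP => -[x P]; rewrite !inE /= pieces_keep inE sub_imset_pre.
by congr (_ && _); apply: eq_subset_r => s; rewrite !inE.
Qed.

(** Taking the state of a split component is the same as restricting the state
of the whole diagram, because a component is a union of whole pieces. *)
Lemma state_subdiagram a D S : S \in components D ->
  state a (subdiagram D S) =1 subdiagram (state a D) S.
Proof.
move=> SD x; apply: splice_keep => P PD /set0Pn[s].
rewrite !inE => /andP[sP sS]; apply/subsetP => r rP; rewrite inE.
have xP : (x, P) \in piece_set D by rewrite inE.
have /subsetP := comps_saturated SD xP (imset_f (midpoint x) sP) sS.
by apply; apply: imset_f.
Qed.

Lemma piece_set_state_subdiagram a D S : S \in components D ->
  piece_set (state a (subdiagram D S))
  = within (@piece_ends m n) (piece_set (state a D)) S.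
Proof.
by move=> SD; rewrite (eq_piece_set (state_subdiagram a SD)) piece_set_subdiagram.
Qed.

(** What one of the two states M contributes to the Euler characteristic: a disk
for each of its circles and an edge for each of its arcs. *)
Definition caps_minus_arcs M : int := #|components M|%:Z - #|piece_set M|%:Z.

Lemma eq_caps_minus_arcs D M : D =1 M -> caps_minus_arcs D = caps_minus_arcs M.
Proof.
by move=> /eq_piece_set DM; rewrite /caps_minus_arcs !components_piece_set DM.
Qed.

(** The coefficient 1 of the number of points is 2 - 1: two vertices and one
vertical edge for each. *)
Lemma euler_turaev_nonsplit D :
  euler (turaev_nonsplit D)
  = #|piece_set D|%:Z + #|support D|%:Z
    + (caps_minus_arcs (state true D) + caps_minus_arcs (state false D)).
Proof.
rewrite /euler /= /turaev_vertex /turaev_edge /turaev_face.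
rewrite !card_sum card_prod card_bool !card_sig.
rewrite /caps_minus_arcs -[stateA D]/(state true D) -[stateB D]/(state false D).
have cardE (T : finType) (A : {set T}) : #|[pred z | z \in A]| = #|A|.
  exact: eq_card.
rewrite !cardE; lia.
Qed.

End Mosaic.

Lemma posz_sum (I : Type) (r : seq I) (P : pred I) (F : I -> nat) :
  (\sum_(i <- r | P i) F i)%N%:Z = \sum_(i <- r | P i) (F i)%:Z.
Proof. by rewrite -natz natr_sum; apply: eq_bigr => i _; rewrite natz. Qed.

Lemma euler_disjoint_union (I : finType) (K : I -> complex) :
  euler (disjoint_union K) = \sum_i euler (K i).
Proof.
have card_sum (T : I -> finType) : #|{: {i : I & T i}}|%:Z = \sum_i #|T i|%:Z.
  by rewrite card_tagged sumnE big_map big_enum posz_sum.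
by rewrite /euler /= !card_sum big_split sumrB.
Qed.

(** Each cell lies over exactly one split component, so cutting the diagram into
its split components neither loses nor repeats a cell. *)
Lemma euler_turaev m n (D : mosaic m n) :
  euler (turaev D) = euler (turaev_nonsplit D).
Proof.
rewrite euler_disjoint_union.
rewrite -(big_sub (components D)
  (fun S => euler (turaev_nonsplit (subdiagram D S)))).
have n0 M : {in piece_set M, forall u : local_piece m n, piece_ends u != set0}.
  by move=> u; apply: piece_ends_n0.
have refl : {in piece_set D, forall u, exists2 v, v \in piece_set D
    & piece_ends u \subset piece_ends v} by move=> u; exists u.
under eq_bigr => S _ do rewrite euler_turaev_nonsplit.
(* A fourth splitting would unfold [caps_minus_arcs]. *)
rewrite euler_turaev_nonsplit 3!big_split /=.
have capE a : \sum_(S in components D) caps_minus_arcs (state a (subdiagram D S))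
    = caps_minus_arcs (state a D).
  rewrite sumrB -!posz_sum; congr (_%:Z - _%:Z).
    rewrite -(sum_card_comps_within (state_refine (D := D)) (support_state a D)).
    by apply: eq_bigr => S SD; rewrite components_piece_set piece_set_state_subdiagram.
  rewrite -(sum_card_within (n0 _) (state_refine (D := D)) (support_state a D)).
  by apply: eq_bigr => S SD; rewrite piece_set_state_subdiagram.
rewrite !capE -!posz_sum; congr (_%:Z + _%:Z + _).
  rewrite -(sum_card_within (n0 _) refl erefl).
  by apply: eq_bigr => S SD; rewrite piece_set_subdiagram.
rewrite (support_piece_set D) -(sum_card_hull_within refl erefl).
by apply: eq_bigr => S SD; rewrite support_piece_set piece_set_subdiagram.
Qed.

Lemma card_piece_set m n (D : mosaic m n) :
  #|piece_set D| = (\sum_x #|pieces (D x)|)%N.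
Proof.
under [RHS]eq_bigr => x _ do rewrite -sum1_card.
by rewrite pair_big_dep -sum1_card; apply: eq_bigl => u; rewrite inE.
Qed.

(** * Splicing one crossing *)

Section SpliceOneCrossing.

Variables (m n : nat) (D M : mosaic m n) (a : bool) (x : square m n) (b : bool).
Hypothesis crossing : D x = Crossing b.
Hypothesis spliced : M x = splice a (D x).
Hypothesis unchanged : forall y, y <> x -> M y = D y.

(** The tile at x becomes the a-splicing of the crossing on both sides, since
splicing a crossingless tile changes nothing. *)
Lemma state_spliced : state a M =1 state a D.
Proof.
move=> y; rewrite /state; have [->|/eqP/unchanged-> //] := eqVneq y x.
by rewrite spliced crossing.
Qed.

(** Each of D and M has the support of its a-state, and these states agree. *)
Lemma support_spliced : support M = support D.
Proof.
rewrite -(support_state a M) -(support_state a D) !support_piece_set.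
by rewrite (eq_piece_set state_spliced).
Qed.

Lemma card_piece_set_spliced : #|piece_set M| = #|piece_set D|.+1.
Proof.
rewrite !card_piece_set (bigD1 x) // [in RHS](bigD1 x) //=.
rewrite spliced crossing card_pieces_splice cards1; congr _.+2.
by apply: eq_bigr => y /eqP/unchanged->.
Qed.

Lemma caps_minus_arcs_spliced :
  caps_minus_arcs (state a M) = caps_minus_arcs (state a D).
Proof. exact: eq_caps_minus_arcs state_spliced. Qed.

End SpliceOneCrossing.

Theorem theorem5p1 (m n : nat) (Lp Lm L0 Loo : diagram m n) (x : square m n)
  (b : bool)
  (hLp : Lp x = Crossing b)
  (hLm : Lm x = crossing_change (Lp x))
  (hL0 : L0 x = spliceA (Lp x))
  (hLoo : Loo x = spliceB (Lp x))
  (hout : forall y : square m n, y <> x ->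
     [/\ Lm y = Lp y, L0 y = Lp y & Loo y = Lp y]) :
  euler (turaev Lp) + euler (turaev Lm)
    = euler (turaev L0) + euler (turaev Loo) - 2.
Proof.
have Lmx : Lm x = Crossing (~~ b) by rewrite hLm hLp.
have L0_of_Lp y : y <> x -> L0 y = Lp y by case/hout.
have Loo_of_Lp y : y <> x -> Loo y = Lp y by case/hout.
have L0_of_Lm y : y <> x -> L0 y = Lm y by case/hout => -> ->.
have Loo_of_Lm y : y <> x -> Loo y = Lm y by case/hout => -> _ ->.
have spl_p0 : L0 x = splice true (Lp x) by [].
have spl_poo : Loo x = splice false (Lp x) by [].
have spl_m0 : L0 x = splice false (Lm x) by rewrite hL0 hLp Lmx.
have spl_moo : Loo x = splice true (Lm x) by rewrite hLoo hLp Lmx /= negbK.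
rewrite !euler_turaev !euler_turaev_nonsplit.
rewrite (support_spliced hLp spl_p0 L0_of_Lp) (support_spliced hLp spl_poo Loo_of_Lp).
rewrite -(support_spliced Lmx spl_m0 L0_of_Lm) (support_spliced hLp spl_p0 L0_of_Lp).
rewrite (card_piece_set_spliced hLp spl_p0 L0_of_Lp).
rewrite (card_piece_set_spliced Lmx spl_moo Loo_of_Lm).
rewrite (caps_minus_arcs_spliced hLp spl_p0 L0_of_Lp).
rewrite (caps_minus_arcs_spliced hLp spl_poo Loo_of_Lp).
rewrite (caps_minus_arcs_spliced Lmx spl_m0 L0_of_Lm).
rewrite (caps_minus_arcs_spliced Lmx spl_moo Loo_of_Lm).
lia.
Qed.
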